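(* For any graph $G=([n],E)$, the parameter $f_G^{(1)}$ is finite or, equivalently, $f_G^{(1)}=1/\alpha(G)$, if and only if $G$ is a disjoint union of cliques.
   Context: Graphs are finite and simple. $\alpha(G)$ is the maximum cardinality of a stable set of $G$, $A_G$ is the adjacency matrix, $I$ the identity matrix, and $f_G(x)=x^T(I+A_G)x$. $G$ is a disjoint union of cliques if its vertex set is partitioned into cliques with no edges between different cliques. $\Sigma$ is the set of sums of squares of real polynomials in $x=(x_1,\dots,x_n)$. With $\mathcal{M}(x_1,\dots,x_n)_r=\{\sigma_0+\sum_{j=1}^n\sigma_jx_j:\sigma_j\in\Sigma,\ \deg(\sigma_0)\le2r,\ \deg(\sigma_jx_j)\le2r\}$ and $\langle h\rangle_k=\{uh:u\in\mathbb{R}[x],\deg(uh)\le k\}$, define $$f_G^{(1)}=\sup\Big\{\lambda\in\mathbb{R}:f_G-\lambda\in\mathcal{M}(x_1,\dots,x_n)_1+\Big\langle1-\sum_{i=1}^nx_i\Big\rangle_2\Big\},$$ with $\sup\emptyset=-\infty$; ''finite'' means that this program is feasible. *)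

(* Defs.v *)
From HB Require Import structures.
From mathcomp Require Import all_boot all_order all_algebra.
From mathcomp Require Import classical_sets reals constructive_ereal ereal.
(* The notations of multinomials clash with those of classical_sets. *)
From mathcomp Require Import -(notations) mpoly.

Set Implicit Arguments.
Unset Strict Implicit.
Unset Printing Implicit Defensive.

Import GRing.Theory Num.Theory.
Local Open Scope ring_scope.

Notation "{ 'mpoly' R [ n ] }" := (mpoly n R)
  (at level 0, R, n at level 2, format "{ 'mpoly'  R [ n ] }") : type_scope.

Section Graphs.
Variables (n : nat) (E : rel 'I_n).

Definition stable (S : {set 'I_n}) : bool :=
  [forall i in S, forall j in S, ~~ E i j].

Definition alpha : nat := \max_(S : {set 'I_n} | stable S) #|S|.

Definition clique (K : {set 'I_n}) : bool :=
  [forall i in K, forall j in K, (i != j) ==> E i j].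

Definition disjoint_union_of_cliques : Prop :=
  exists P : {set {set 'I_n}},
    [/\ finset.partition P [set: 'I_n]%SET,
        forall K, K \in P -> clique K
      & forall K L, K \in P -> L \in P -> K != L ->
          forall i j, i \in K -> j \in L -> ~~ E i j].

Definition adjacency (R : nzRingType) : 'M[R]_n := \matrix_(i, j) (E i j)%:R.

End Graphs.

Section Polynomials.
Variables (R : realType) (n : nat).
Implicit Types (p q h u : {mpoly R[n]}) (k r : nat).

Definition var (i : 'I_n) : {mpoly R[n]} := mpolyX R (mnm1 i).

(* [msize p] is one plus the total degree of [p], and [msize 0 = 0]. *)
Definition deg_le k p : bool := (msize p <= k.+1)%N.

Definition sos p : Prop := exists s : seq {mpoly R[n]}, p = \sum_(q <- s) q ^+ 2.

(* The truncated quadratic module M(x_1, ..., x_n)_r. *)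
Definition quad_module r : set {mpoly R[n]} :=
  [set p | exists (s0 : {mpoly R[n]}) (s : 'I_n -> {mpoly R[n]}),
     [/\ sos s0, forall j, sos (s j),
         deg_le (2 * r) s0, forall j, deg_le (2 * r) (s j * var j)
       & p = s0 + \sum_(j < n) s j * var j]]%classic.

(* The truncated ideal <h>_k. *)
Definition trunc_ideal h k : set {mpoly R[n]} :=
  [set p | exists u, deg_le k (u * h) /\ p = u * h]%classic.

Variable E : rel 'I_n.

(* f_G(x) = x^T (I + A_G) x *)
Definition fG : {mpoly R[n]} :=
  let x : 'cV[{mpoly R[n]}]_n := \col_i var i in
  (x^T *m map_mx (@mpolyC n R) (1%:M + adjacency E R) *m x) 0 0.

Definition feasible1 : set R :=
  [set lam : R | exists p q,
     [/\ quad_module 1 p,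
         trunc_ideal (1 - \sum_(i < n) var i) 2 q
       & fG - mpolyC n lam = p + q]]%classic.

(* [ereal_sup set0 = -oo] *)
Definition fG1 : \bar R := ereal_sup [set lam%:E | lam in feasible1]%classic.

End Polynomials.

Arguments feasible1 R [n] E _.

(* Main.v *)
(** If [i - j - k] is an induced path, then [f_G] is negative at
    [v = e_i + e_k - 2 e_j], and the coordinates of [v] sum to [0]. Restrict a
    certificate to the line [x + t v] inside the hyperplane [sum x = 1]: each
    [sigma_j] has degree at most [1] and is nonnegative, hence is constant on
    the line, so the certificate decreases at most linearly in [t] whereas [f_G]
    decreases quadratically. Therefore feasibility forces adjacency-or-equality
    to be transitive.

    Conversely, if [V] is the disjoint union of cliques [K] in [P], then
    [f_G = sum_K (sum_{i in K} x_i)^2], and completing the squares at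
    [1 / #|P|] gives a certificate of [1 / #|P|]. Evaluating any certificate at
    the uniform point of a maximum stable set bounds the value by
    [1 / alpha G], and [#|P| <= alpha G] because a transversal of [P] is
    stable. *)
Require Import Defs.
(* Required first because mpoly has its own [symmetric]. *)
From mathcomp Require Import -(notations) mpoly.
From mathcomp Require Import all_boot all_order all_algebra.
From mathcomp Require Import classical_sets reals constructive_ereal ereal.
From mathcomp Require Import ring lra.

Set Implicit Arguments.
Unset Strict Implicit.
Unset Printing Implicit Defensive.

Import Order.TTheory GRing.Theory Num.Theory.
Local Open Scope ring_scope.

(** * Degree bounds, and evaluation of affine polynomials and sums of squares *)

Section Degree.
Variables (R : realType) (n : nat).
Implicit Types (p q : {mpoly R[n]}) (x v : 'I_n -> R).

Lemma deg_leM a b p q : deg_le a p -> deg_le b q -> deg_le (a + b) (p * q).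
Proof.
rewrite /deg_le => pa qb.
have [->|p0] := eqVneq p 0; first by rewrite mul0r msize0.
have [->|q0] := eqVneq q 0; first by rewrite mulr0 msize0.
rewrite msizeM // -subn1 leq_subLR (leq_trans (leq_add pa qb)) //.
by rewrite addnS addSn add1n.
Qed.

Lemma deg_leD a p q : deg_le a p -> deg_le a q -> deg_le a (p + q).
Proof.
by rewrite /deg_le => pa qa; rewrite (leq_trans (msizeD_le _ _)) // geq_max pa.
Qed.

Lemma deg_leN a p : deg_le a (- p) = deg_le a p.
Proof. by rewrite /deg_le msizeN. Qed.

Lemma deg_le_sum a (I : Type) (r : seq I) (P : pred I) (F : I -> {mpoly R[n]}) :
  (forall i, P i -> deg_le a (F i)) -> deg_le a (\sum_(i <- r | P i) F i).
Proof.
move=> Fa; elim/big_rec: _ => [|i p Pi pa]; first by rewrite /deg_le msize0.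
by rewrite deg_leD ?Fa.
Qed.

Lemma deg_leC a (c : R) : deg_le a (mpolyC n c).
Proof. by rewrite /deg_le msizeC; case: (c == 0). Qed.

Lemma deg_le_var a (i : 'I_n) : deg_le a.+1 (var R i).
Proof. by rewrite /deg_le /var msizeX mdeg1. Qed.

Lemma deg_le_var_factor a p (i : 'I_n) :
  deg_le a.+1 (p * var R i) -> deg_le a p.
Proof.
rewrite /deg_le /var; have [->|p0] := eqVneq p 0; first by rewrite msize0.
by rewrite msizeM ?msizeX ?mdeg1 ?addn2 // -msize_poly_eq0 msizeX.
Qed.

(** A monomial of degree at most 1 is a variable or 1, and both satisfy this midpoint identity. In
    [feasible_direction] it makes the total weight of a multiplier at two opposite points
    independent of their distance from [x]. *)
Lemma meval_affine p x v : deg_le 1 p ->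
  meval (fun i => x i + v i) p + meval (fun i => x i - v i) p = meval x p *+ 2.
Proof.
move=> p1; rewrite !mevalE -big_split -sumrMnl /=; apply: eq_big_seq => m mp.
rewrite -mulrDr -mulrnAr; congr (_ * _).
have: (mdeg m <= 1)%N by rewrite -ltnS (leq_trans (msize_mdeg_lt mp)).
rewrite leq_eqVlt ltnS leqn0 mdeg_eq0 => /orP[/mdeg1P[i]|] /eqP ->.
  by have := mmap1U x i; have := mmap1U (fun i => x i + v i) i;
    have := mmap1U (fun i => x i - v i) i; rewrite /mmap1 => -> -> ->; ring.
by rewrite !big1 // => i _; rewrite mnm0E.
Qed.

Lemma sos_ge0 p x : sos p -> 0 <= meval x p.
Proof.
by case=> s ->; rewrite raddf_sum sumr_ge0 // => q _;
  rewrite /= rmorphXn sqr_ge0.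
Qed.

End Degree.

(** * Bounds and transitivity forced by a certificate *)

Section Certificates.
Variables (R : realType) (n : nat) (E : rel 'I_n).
Implicit Types (x v : 'I_n -> R) (lam : R).

Let reflE i j := (i == j) || E i j.

Lemma fGE : irreflexive E ->
  fG R E = \sum_i \sum_j mpolyC n (reflE i j)%:R * (var R i * var R j).
Proof.
move=> Eirr; rewrite /fG mxE exchange_big; apply: eq_bigr => j _.
rewrite mxE mulr_suml; apply: eq_bigr => i _; rewrite !mxE -mulrA mulrCA.
congr (mpolyC n _ * _); rewrite /reflE -natrD; congr (_%:R).
by have [->|] := eqVneq i j; rewrite ?Eirr.
Qed.

Lemma meval_fG x : irreflexive E ->
  meval x (fG R E) = \sum_i x i * \sum_j (reflE i j)%:R * x j.
Proof.
move=> Eirr; rewrite fGE // raddf_sum; apply: eq_bigr => i _.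
rewrite raddf_sum mulr_sumr; apply: eq_bigr => j _ /=.
by rewrite !mevalM mevalC !mevalXU mulrCA.
Qed.

(** The ideal term vanishes on the hyperplane, and cancelling the factor x_j leaves multipliers of
    degree at most 1. *)
Lemma certificate_eval lam : feasible1 R E lam ->
  exists s0 (s : 'I_n -> {mpoly R[n]}),
    [/\ sos s0, forall j, sos (s j), forall j, deg_le 1 (s j)
      & forall x, \sum_i x i = 1 -> meval x (fG R E) - lam =
          meval x s0 + \sum_j meval x (s j) * x j].
Proof.
case=> p [q [[s0 [s [sos0 sosj _ degj ->]]] [u [_ ->]] fE]].
exists s0, s; split=> // [j|x x1]; first exact: deg_le_var_factor (degj j).
have varE : meval x (\sum_i var R i) = 1.
  by rewrite raddf_sum -x1; apply: eq_bigr => i _; apply: mevalXU.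
have := congr1 (meval x) fE; rewrite mevalB mevalC => ->.
rewrite !mevalD mevalM mevalB meval1 varE subrr mulr0 addr0 raddf_sum.
by congr (_ + _); apply: eq_bigr => j _; rewrite /= mevalM mevalXU.
Qed.

Lemma certificate_bound lam x : feasible1 R E lam ->
  \sum_i x i = 1 -> (forall i, 0 <= x i) -> lam <= meval x (fG R E).
Proof.
move=> /certificate_eval[s0 [s [sos0 sosj _ fE]]] x1 x0.
rewrite -subr_ge0 fE // addr_ge0 ?sos_ge0 // sumr_ge0 // => j _.
by rewrite mulr_ge0 ?sos_ge0.
Qed.

(** Adding the certificate at x + t v and x - t v cancels the part of f_G linear in t, while the two
    values of each multiplier sum to twice its value at [x]. The certificate is thus bounded below
    linearly in t, whereas f_G contributes t^2 f_G(v). *)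
Lemma feasible_direction lam v : irreflexive E -> (0 < n)%N ->
  feasible1 R E lam -> \sum_i v i = 0 -> 0 <= meval v (fG R E).
Proof.
move=> Eirr n_gt0 /certificate_eval[s0 [s [sos0 sosj degj fE]]] v0.
pose x i : R := (i == Ordinal n_gt0)%:R.
have x1 : \sum_i x i = 1.
  by rewrite (bigD1 (Ordinal n_gt0)) //= big1 /x ?eqxx ?addr0 // => i /negPf->.
pose A := \sum_j meval x (s j) * `|x j|.
pose B := \sum_j meval x (s j) * `|v j|.
have B_ge0 : 0 <= B by rewrite sumr_ge0 // => j _; rewrite mulr_ge0 ?sos_ge0.
set q := meval v _; pose C := meval x (fG R E) - lam + A.
have line t : 0 <= t -> 0 <= C + t * B + t ^+ 2 * q.
  move=> t_ge0.
  pose yp i := x i + t * v i; pose ym i := x i - t * v i.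
  have yp1 : \sum_i yp i = 1 by rewrite big_split /= -mulr_sumr v0 mulr0 addr0.
  have ym1 : \sum_i ym i = 1 by rewrite sumrB -mulr_sumr v0 mulr0 subr0.
  have fpm : meval yp (fG R E) + meval ym (fG R E) =
      (meval x (fG R E) + t ^+ 2 * q) *+ 2.
    rewrite !meval_fG // /q meval_fG // mulr_sumr -!big_split -sumrMnl.
    apply: eq_bigr => i _ /=; rewrite !mulr_sumr -!big_split -sumrMnl.
    by apply: eq_bigr => j _ /=; rewrite /yp /ym; ring.
  (* Both weights are nonnegative and multiply coordinates of absolute value at most |x_j| + t
     |v_j|. *)
  have term j : - ((meval x (s j) * (`|x j| + t * `|v j|)) *+ 2) <=
      meval yp (s j) * yp j + meval ym (s j) * ym j.
    rewrite -mulrnAl -(meval_affine x (fun i => t * v i) (degj j)) -/yp -/ym.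
    have tvE : t * `|v j| = `|t * v j| by rewrite normrM (ger0_norm t_ge0).
    rewrite mulrDl opprD -!mulrN tvE lerD // ler_wpM2l ?sos_ge0 //.
      by rewrite lerNl (le_trans _ (ler_normD _ _)) // -normrN ler_norm.
    by rewrite lerNl (le_trans _ (ler_normB _ _)) // -normrN ler_norm.
  have : - ((A + t * B) *+ 2) <= \sum_j meval yp (s j) * yp j
      + \sum_j meval ym (s j) * ym j.
    rewrite /A /B mulr_sumr -!big_split -sumrMnl -sumrN.
    apply: ler_sum => j _ /=; apply: le_trans (term j).
    by rewrite mulrDr [t * (_ * _)]mulrCA.
  have := fE _ yp1; have := fE _ ym1.
  by have := sos_ge0 yp sos0; have := sos_ge0 ym sos0; rewrite /C; lra.
rewrite leNgt; apply/negP => q_lt0.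
(* For this t, t q = q - |C| - B, so the expression in [line] equals C - t |C| + t q, which is
   negative because t >= 1 and q < 0. *)
pose t := 1 + (`|C| + B) / - q.
have qE : t * - q = - q + (`|C| + B) by rewrite /t; field; rewrite lt_eqF.
have t_ge1 : 1 <= t by rewrite /t lerDl divr_ge0 ?addr_ge0 // oppr_ge0 ltW.
have := line t (le_trans ler01 t_ge1).
have := ler_norm C; have := normr_ge0 C.
have -> : t ^+ 2 * q = - (t * (- q + (`|C| + B))) by rewrite -qE; ring.
nra.
Qed.

Lemma alpha_gt0 : irreflexive E -> (0 < n)%N -> (0 < alpha E)%N.
Proof.
move=> Eirr n_gt0; rewrite -(cards1 (Ordinal n_gt0)).
apply: leq_bigmax_cond; apply/forall_inP => i /set1P->.
by apply/forall_inP => j /set1P->; rewrite Eirr.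
Qed.

Lemma feasible_le_inv_alpha lam : irreflexive E -> (0 < n)%N ->
  feasible1 R E lam -> lam <= (alpha E)%:R^-1.
Proof.
move=> Eirr n_gt0 feas; have a_gt0 := alpha_gt0 Eirr n_gt0.
have [|S stS aE] := @eq_bigmax_cond _ (stable E) (fun S => #|S|).
  apply/card_gt0P; by exists finset.set0; apply/forall_inP => i; rewrite inE.
rewrite -/(alpha E) in aE.
pose x i : R := (i \in S)%:R * (alpha E)%:R^-1.
have a0 : (alpha E)%:R != 0 :> R by rewrite pnatr_eq0 -lt0n.
have SE : (\sum_i (i \in S) = alpha E)%N.
  by rewrite aE -sum1_card [RHS]big_mkcond; apply: eq_bigr => i _; case: ifP.
have x1 : \sum_i x i = 1 by rewrite -mulr_suml -natr_sum SE divff.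
have x_ge0 i : 0 <= x i by rewrite mulr_ge0 ?invr_ge0.
apply: le_trans (certificate_bound feas x1 x_ge0) _.
(* As the x_i sum to 1, summands can be compared one by one: for i in [S], stability leaves only j =
   i in the inner sum. *)
rewrite meval_fG // -[leRHS]mul1r -[X in _ <= X * _]x1 mulr_suml.
rewrite ler_sum // => i _.
case: (boolP (i \in S)) => [iS|/negPf iS]; last by rewrite /x iS !mul0r.
rewrite ler_wpM2l // (bigD1 i) //= /reflE eqxx /= mul1r /x iS mul1r.
rewrite big1 ?addr0 // => j ji; rewrite eq_sym (negPf ji) /=.
have [jS|_] := boolP (j \in S); last by rewrite !mul0r mulr0.
have /forall_inP/(_ i iS)/forall_inP/(_ j jS)/negPf-> := stS.
by rewrite mul0r.
Qed.

Lemma feasible_trans lam : symmetric E -> irreflexive E ->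
  feasible1 R E lam -> transitive reflE.
Proof.
move=> Esym Eirr feas j i k; rewrite /reflE.
case: (eqVneq i j) => [->//|ij] /=.
case: (eqVneq j k) => [<- -> _|jk] /=; first by rewrite orbT.
case: (eqVneq i k) => [//|ik] /=.
move=> Eij Ejk; apply/negPn/negP => nEik.
have n_gt0 : (0 < n)%N := leq_ltn_trans (leq0n i) (ltn_ord i).
pose v p : R := (p == i)%:R + (p == k)%:R - 2 * (p == j)%:R.
have vE (F : 'I_n -> R) : \sum_p v p * F p = F i + F k - 2 * F j.
  have d l : \sum_p (p == l)%:R * F p = F l.
    rewrite (bigD1 l) //= big1 ?eqxx ?mul1r ?addr0 // => p /negPf->.
    by rewrite mul0r.
  rewrite -(d i) -(d j) -(d k) mulr_sumr -big_split -sumrB.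
  by apply: eq_bigr => p _ /=; rewrite /v; ring.
have v0 : \sum_p v p = 0.
  by have := vE (fun=> 1); under eq_bigr do rewrite mulr1; move=> ->; ring.
have := feasible_direction Eirr n_gt0 feas v0.
rewrite meval_fG //; under eq_bigr do under eq_bigr do rewrite mulrC.
(* The inner sums are -1 at i and k and 0 at j, so f_G(v) = -2. *)
rewrite vE !vE /reflE !eqxx !Eirr (eq_sym k i) (eq_sym k j) (eq_sym j i).
rewrite (negPf ij) (negPf jk) (negPf ik) (Esym k) (Esym j i) (Esym k j).
rewrite Eij Ejk (negPf nEik) /=; lra.
Qed.

End Certificates.

(** * From transitivity to cliques, and from cliques to a certificate *)

Section Cliques.
Variables (R : realType) (n : nat) (E : rel 'I_n).

Lemma trans_disjoint_cliques : symmetric E ->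
  transitive (fun i j => (i == j) || E i j) -> disjoint_union_of_cliques E.
Proof.
set r := (fun i j => _) => Esym rtrans.
have rsym : symmetric r by move=> i j; rewrite /r eq_sym Esym.
have req : {in [set: 'I_n]%SET & &, equivalence_rel r}.
  apply: in3W; apply/equivalence_relP; split=> [i|].
    by rewrite /r eqxx.
  exact/left_trans.
exists (equivalence_partition r [set: 'I_n]%SET); split.
- exact: equivalence_partitionP.
- move=> _ /imsetP[l _ ->]; apply/forall_inP => i; rewrite !inE /= => li.
  apply/forall_inP => j; rewrite !inE /= => lj; apply/implyP => ij.
  have := rtrans l i j; rewrite [r i l]rsym => /(_ li lj).
  by rewrite /r (negPf ij).
(* An edge between two classes puts its ends in one class, so the classes coincide. *)
move=> K L PK PL KL i j iK jL; apply: contraNN KL => Eij.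
have tP := partition_trivIset (equivalence_partitionP req).
rewrite -(def_pblock tP PK iK) -(def_pblock tP PL jL) eq_pblock //; last first.
  by rewrite (cover_partition (equivalence_partitionP req)).
by rewrite pblock_equivalence_partition // /r Eij orbT.
Qed.

Section Partition.
Variable P : {set {set 'I_n}}.
Hypothesis partP : finset.partition P [set: 'I_n]%SET.
Hypothesis cliqueP : forall K, K \in P -> clique E K.
Hypothesis separatedP : forall K L, K \in P -> L \in P -> K != L ->
  forall i j, i \in K -> j \in L -> ~~ E i j.

Let tP := partition_trivIset partP.

Let covP i : i \in finset.cover P.
Proof. by rewrite (cover_partition partP). Qed.

(** Cliques give one direction and separation the other; I + A_G thereby becomes block diagonal with
    all-ones blocks. *)
Lemma mem_pblock_adj i j : (j \in finset.pblock P i) = (i == j) || E i j.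
Proof.
have iK : i \in finset.pblock P i by rewrite mem_pblock.
have PK := pblock_mem (covP i).
have [<-|ij] /= := eqVneq i j; first by rewrite iK.
apply/idP/idP => [jK|].
  by have /forall_inP/(_ i iK)/forall_inP/(_ j jK)/implyP := cliqueP PK; apply.
rewrite -eq_pblock //; apply: contraLR => KL.
by apply: separatedP KL _ _ iK _; rewrite ?pblock_mem ?mem_pblock.
Qed.

Lemma fG_sum_cliques : irreflexive E ->
  fG R E = \sum_(K in P) (\sum_(i in K) var R i) ^+ 2.
Proof.
move=> Eirr; rewrite fGE //.
rewrite (eq_bigl [in finset.cover P]) => [|i]; last by rewrite covP.
rewrite big_trivIset //; apply: eq_bigr => K PK; rewrite expr2 mulr_suml.
apply: eq_bigr => i iK; rewrite mulr_sumr [RHS]big_mkcond /=.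
apply: eq_bigr => j _; rewrite -mem_pblock_adj (def_pblock tP PK iK).
by case: ifP => _; rewrite ?mpolyC1 ?mul1r // mpolyC0 mul0r.
Qed.

(* With [y_K] the sum of the variables in [K], this is
   [sum_K y_K^2 = sum_K (y_K - c)^2 + 2 c sum_K y_K - c^2 #|P|]. *)
Lemma cliques_feasible c lam : irreflexive E ->
  lam + c ^+ 2 * #|P|%:R = c *+ 2 -> feasible1 R E lam.
Proof.
move=> Eirr lamE; pose y (K : {set 'I_n}) := \sum_(i in K) var R i.
pose sq := \sum_(K in P) (y K - mpolyC n c) ^+ 2.
have yP : \sum_(K in P) y K = \sum_i var R i.
  by rewrite -big_trivIset //; apply: eq_bigl => i; rewrite covP.
(* Since lam = 2 c - c^2 #|P|, what remains after the squares is 2 c (sum x_i - 1), a multiple of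
   the generator. *)
exists sq, (mpolyC n (- c *+ 2) * (1 - \sum_i var R i)).
split.
- exists sq, (fun=> 0); split.
  + by exists [seq y K - mpolyC n c | K <- enum P]; rewrite big_map big_enum.
  + by move=> j; exists [::]; rewrite big_nil.
  + apply: deg_le_sum => K _; rewrite expr2.
    have deg1 : deg_le 1 (y K - mpolyC n c).
      rewrite deg_leD ?deg_leN ?deg_leC //.
      by apply: deg_le_sum => i _; apply: deg_le_var.
    exact: (deg_leM deg1 deg1).
  + by move=> j; rewrite mul0r /deg_le msize0.
  + by rewrite [X in _ + X]big1 ?addr0 // => j _; rewrite mul0r.
- exists (mpolyC n (- c *+ 2)); split=> //.
  apply: (@deg_leM _ _ 0 2); first exact: deg_leC.
  rewrite deg_leD ?deg_leN -?mpolyC1 ?deg_leC //.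
  by apply: deg_le_sum => i _; apply: deg_le_var.
have -> : lam = c *+ 2 - c ^+ 2 * #|P|%:R by rewrite -lamE addrK.
rewrite fG_sum_cliques // /sq -yP.
under [X in _ = X + _]eq_bigr do rewrite sqrrB.
rewrite big_split sumrB sumrMnl -mulr_suml sumr_const -mulr_natr /=.
set S := \sum_(K in P) y K ^+ 2; set T := \sum_(K in P) y K.
ring.
Qed.

Lemma card_cliques_le_alpha : irreflexive E -> (#|P| <= alpha E)%N.
Proof.
move=> Eirr; have trX := transversalP partP; rewrite -(card_transversal trX).
apply: leq_bigmax_cond; apply/forall_inP => i iX; apply/forall_inP => j jX.
apply/negP => Eij.
have : j \in finset.pblock P i by rewrite mem_pblock_adj Eij orbT.
rewrite -eq_pblock // => /eqP /(pblock_inj trX iX jX) ij.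
by move: Eij; rewrite ij Eirr.
Qed.

End Partition.

End Cliques.

(** The empty sum makes the generator equal to 1, so the ideal contains every constant. *)
Lemma feasible1_dim0 (R : realType) (E : rel 'I_0) lam : feasible1 R E lam.
Proof.
exists 0, (mpolyC 0 (- lam) * (1 - \sum_(i < 0) var R i)); split.
- exists 0, (fun=> 0); split; rewrite ?big_ord0 ?addr0 //.
  + by exists [::]; rewrite big_nil.
  + by case.
  + by rewrite /deg_le msize0.
  + by case.
- exists (mpolyC 0 (- lam)); split=> //.
  by rewrite big_ord0 subr0 mulr1 deg_leC.
by rewrite big_ord0 subr0 mulr1 add0r mpolyCN /fG mxE big_ord0 sub0r.
Qed.

Theorem lemma3p13 (R : realType) (n : nat) (E : rel 'I_n)
    (Esym : symmetric E) (Eirr : irreflexive E) :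
  ((feasible1 R E !=set0)%classic <-> fG1 R E = ((alpha E)%:R%:E^-1)%E) /\
  ((feasible1 R E !=set0)%classic <-> disjoint_union_of_cliques E).
Proof.
have cliques : (feasible1 R E !=set0)%classic -> disjoint_union_of_cliques E.
  by case=> lam /(feasible_trans Esym Eirr); apply: trans_disjoint_cliques.
have value : disjoint_union_of_cliques E -> fG1 R E = ((alpha E)%:R%:E^-1)%E.
  case=> P [partP cliqueP sepP]; case: (posnP n) => [n0|n_gt0].
    (* For the empty graph both sides are +oo: the extended inverse of 0, and the supremum of all
       reals. *)
    subst n; have -> : alpha E = 0%N.
      apply/eqP; rewrite -leqn0; apply/bigmax_leqP => S _.
      by rewrite (leq_trans (max_card _)) ?card_ord.
    rewrite inver eqxx; apply/eqyP => r _.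
    by apply: ereal_sup_ubound; exists r => //; apply: feasible1_dim0.
  have a_gt0 := alpha_gt0 Eirr n_gt0.
  rewrite inver pnatr_eq0 gtn_eqF //; apply/le_anti/andP; split.
    apply: ge_ereal_sup => _ [lam feas <-]; rewrite lee_fin.
    exact: feasible_le_inv_alpha feas.
  have P_gt0 : (0 < #|P|)%N.
    apply/card_gt0P; exists (finset.pblock P (Ordinal n_gt0)).
    by rewrite pblock_mem // (cover_partition partP).
  apply: (@le_trans _ _ (#|P|%:R^-1)%:E).
    by rewrite lee_fin lef_pV2 ?posrE ?ltr0n // ler_nat card_cliques_le_alpha.
  apply: ereal_sup_ubound; exists (#|P|%:R^-1) => //.
  (* This c maximizes 2 c - c^2 #|P|, with maximum 1 / #|P|. *)
  apply: (cliques_feasible partP cliqueP sepP (c := #|P|%:R^-1)) => //.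
  by rewrite expr2 -mulrA mulVf ?mulr1 // pnatr_eq0 -lt0n.
have feasible : fG1 R E = ((alpha E)%:R%:E^-1)%E ->
    (feasible1 R E !=set0)%classic.
  (* An empty feasible set has supremum -oo, but the inverse of alpha is real or +oo. *)
  move=> fE; apply/set0P/eqP => feas0; move: fE.
  by rewrite /fG1 feas0 image_set0 ereal_sup0 inver; case: ifP.
split; split=> [feas|H].
- exact/value/cliques.
- exact: feasible.
- exact: cliques.
- exact/feasible/value.
Qed.
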